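(* Let $\mathbb A_\infty$ be the unital associative $\infty$-operad. The canonical co-filtration $\mathbb A_\infty\to\cdots\to\mathrm{R}_k\mathbb A_\infty\to\cdots\to\mathrm{R}_2\mathbb A_\infty\to\mathrm{R}_1\mathbb A_\infty$ is of the form $$\mathbb A_\infty\xrightarrow{\ \simeq\ }\cdots\xrightarrow{\ \simeq\ }\mathrm{R}_3\mathbb A_\infty\to\mathrm{R}_2\mathbb A_\infty\to\mathrm{R}_1\mathbb A_\infty\simeq\mathbb E_\infty,$$ i.e. the canonical maps $\mathbb A_\infty\to\mathrm{R}_k\mathbb A_\infty$ and $\mathrm{R}_{k+1}\mathbb A_\infty\to\mathrm{R}_k\mathbb A_\infty$ are equivalences for all $k\ge3$, and $\mathrm{R}_1\mathbb A_\infty\simeq\mathbb E_\infty$.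
   Context: **Trees.** A (dendroidal) tree $(T,L)$, often written $T$, is a finite poset $T$ with a minimal element (a least element, called the root) such that $\{y\le x\}$ is linearly ordered for every $x\in T$, together with a subset $L$ of the maximal elements of $T$ (the leaves). Elements of $T$ are called edges. For an edge $e$, $v(e)$ is the set of minimal elements of $T_{>e}$, and $|v(e)|$ is the valence of $e$. The edge $\eta$ is $(\{r\},\{r\})$; the $n$-corolla $C_n$ ($n\ge1$) is $\{0,1,\dots,n\}$ with $0$ least, $1,\dots,n$ pairwise incomparable and $L=\{1,\dots,n\}$; $C_0=(\{0\},\varnothing)$. **Category $\Omega$.** Objects are trees; $\mathrm{Hom}_\Omega(T,T')$ is the set of operad maps $\mathrm{Free}(T)\to\mathrm{Free}(T')$, where $\mathrm{Free}(T)$ is the coloured symmetric operad in sets with colours the edges of $T$, freely generated by one operation $v(e)\to e$ for each non-leaf edge $e$. **Closed trees.** A tree is closed if $L=\varnothing$; $\Omega^c\subset\Omega$ is the full subcategory of closed trees. (Explicitly: objects are finite rooted trees and morphisms are order-preserving maps that preserve independence, i.e. send incomparable pairs to incomparable pairs.) The inclusion $\Omega^c\hookrightarrow \Omega$ has left adjoint $(T,L)^c=(T,\varnothing)$; $\overline{C_n}:=C_n^c$. A tree is $k$-dendroidal if all its edges have valence $\le k$ (no condition if $k=\infty$); $\Omega^c_{\le k}\subset\Omega^c$ is the full subcategory of closed $k$-dendroidal trees, $\Omega^c_{\le\infty}=\Omega^c$. **Segal presheaves.** $\mathcal S$ is the $\infty$-category of spaces and $\mathcal P(\mathcal C)=\mathrm{Fun}(\mathcal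 C^{\mathrm{op}},\mathcal S)$. A morphism $f\colon T\to T'$ is a subtree inclusion if it is injective on edges and whenever $f(e_0)\le e'\le f(e_2)$ with $e'\in T'$, $e'$ lies in the image of $f$. For a tree $T$, $(\Omega^{\mathrm{el}})_{/T}\subset\Omega_{/T}$ is the full subcategory of subtree inclusions $f\colon X\to T$ with $X=\eta$ or $X=C_n$ for some $n$, where, if $X=C_n$ has root $x$, the edge $f(x)$ must also have valence $n$. A presheaf $\mathcal F$ on $\Omega^c_{\le k}$ is Segal if for every closed $k$-dendroidal $T$ the canonical map $\mathcal F(T)\to\lim_{X\in((\Omega^{\mathrm{el}})_{/T})^{\mathrm{op}}}\mathcal F(X^c)$ is an equivalence. Let $r\colon\Delta\to\Omega^c_{\le k}$ send $[n]$ to the closure of $(\{0\le1\le\dots\le n\},\{n\})$. A Segal presheaf $\mathcal F$ is complete if $r^*\mathcal F$ is a complete Segal space in the sense of Rezk. **Operads.** $\mathrm{Op}^{\mathrm{un}}_{\le k}$ is the full subcategory of $\mathcal P(\Omega^c_{\le k})$ on complete Segal presheaves; $\mathrm{Op}^{\mathrm{un}}=\mathrm{Op}^{\mathrm{un}}_{\le\infty}$, which is equivalent to the $\infty$-category of unital $\infty$-operads (those with all spaces of nullary operations contractible). $(-)^k=i_k^*\colon\mathrm{Op}^{\mathrm{un}}\to\mathrm{Op}^{\mathrm{un}}_{\le k}$ is restriction along $i_k\colon\Omega^c_{\le k}\hookrightarrow\Omega^c$; $\mathrm{R}_k\colon\mathrm{Op}^{\mathrm{un}}_{\le k}\to\mathrm{Op}^{\mathrm{un}}$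 is its fully faithful right adjoint, given by right Kan extension along $i_k$. For $\mathcal O\in\mathrm{Op}^{\mathrm{un}}$, $\mathrm{R}_k\mathcal O:=\mathrm{R}_k((\mathcal O)^k)$; the co-filtration maps are induced by the units of the adjunctions. **$\mathbb A_\infty$ and $\mathbb E_\infty$.** $\mathbb A_\infty=\mathbb E_1$ has a single colour, and, for a finite set $S$ and the closed corolla $\overline{C_S}$ with set of maximal edges $S$ (for $S\neq\varnothing$), $\mathbb A_\infty(\overline{C_S})$ is the (discrete) set of linear orderings of $S$, with the usual operadic composition by substitution of linear orders; for $S\subset S'$ the map $\mathbb A_\infty(\overline{C_{S'}})\to\mathbb A_\infty(\overline{C_S})$ restricts orderings. $\mathbb E_\infty$ is the unital commutative $\infty$-operad, with one colour and contractible spaces of $n$-ary operations for all $n$. *)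

(* Defs.v *)
From HB Require Import structures.
#[warnings="-notation-overridden"]
From mathcomp Require Import all_boot all_order.
From mathcomp Require Import boolp.

Set Implicit Arguments.
Unset Strict Implicit.
Unset Printing Implicit Defensive.

Import Order.TTheory.

(* Spaces are modelled by simplicial sets, presheaves of spaces by strict
   presheaves of simplicial sets, equivalences of presheaves by levelwise
   homotopy equivalences, and right Kan extensions by the Bousfield-Kan (cobar)
   formula; this presents the corresponding notions for presheaves of spaces on
   Kan-complex-valued presheaves. *)

Declare Scope cat_scope.
Local Open Scope cat_scope.

Record category := Category {
  ob :> Type;
  hom : ob -> ob -> Type;
  idm : forall x, hom x x;
  cmp : forall x y z, hom y z -> hom x y -> hom x z;
  cmp1m : forall x y (f : hom x y), cmp (idm y) f = f;
  cmpm1 : forall x y (f : hom x y), cmp f (idm x) = f;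
  cmpA : forall x y z w (h : hom z w) (g : hom y z) (f : hom x y),
    cmp h (cmp g f) = cmp (cmp h g) f }.

Notation "g \oc f" := (cmp g f) (at level 50, left associativity) : cat_scope.

Section FullSubcategory.
Variables (C : category) (P : C -> Prop).

Definition full : category :=
  @Category {x : C | P x} (fun x y => hom (sval x) (sval y))
    (fun x => idm (sval x)) (fun x y z g f => g \oc f)
    (fun x y f => cmp1m f) (fun x y f => cmpm1 f)
    (fun x y z w h g f => cmpA h g f).

End FullSubcategory.

Record set_presheaf (C : category) := SetPresheaf {
  sec :> C -> Type;
  res : forall x y, hom x y -> sec y -> sec x;
  res1 : forall x (s : sec x), res (idm x) s = s;
  resM : forall x y z (g : hom y z) (f : hom x y) (s : sec z),
    res (g \oc f) s = res f (res g s) }.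

Record set_presheaf_map (C : category) (F G : set_presheaf C) :=
  SetPresheafMap {
  sfun :> forall x, F x -> G x;
  sfun_nat : forall x y (f : hom x y) (s : F y),
    sfun (res f s) = res f (sfun s) }.

Record delta_map (m n : nat) := DeltaMap {
  dfun :> 'I_m.+1 -> 'I_n.+1;
  dfun_mono : forall i j : 'I_m.+1, (i <= j)%N -> (dfun i <= dfun j)%N }.

Lemma delta_map_eq m n (f g : delta_map m n) : f =1 g -> f = g.
Proof.
case: f g => [f fm] [g gm] /= /funext e; subst g.
by congr DeltaMap; apply: Prop_irrelevance.
Qed.

Definition delta_id n : delta_map n n :=
  @DeltaMap n n (fun i => i) (fun _ _ ij => ij).

Definition delta_comp m n p (g : delta_map n p) (f : delta_map m n) :
    delta_map m p :=
  @DeltaMap m p (fun i => g (f i))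
    (fun _ _ ij => dfun_mono g (dfun_mono f ij)).

Definition Delta : category.
Proof.
refine (@Category nat delta_map delta_id delta_comp _ _ _) => *;
  exact: delta_map_eq.
Defined.

Definition sset := set_presheaf Delta.
Definition smap (X Y : sset) := set_presheaf_map X Y.

Definition smap_id (X : sset) : smap X X.
Proof. by exists (fun n s => s). Defined.

Definition smap_comp (X Y Z : sset) (g : smap Y Z) (f : smap X Y) : smap X Z.
Proof. by exists (fun n s => g n (f n s)) => m n t s; rewrite !sfun_nat. Defined.

Definition simplex (n : nat) : sset.
Proof.
exists (fun m => delta_map m n) (fun m p (t : delta_map m p) s => delta_comp s t) => *;
  exact: delta_map_eq.
Defined.

Definition sprod (X Y : sset) : sset.
Proof.
exists (fun n => (X n * Y n)%type)
  (fun m n (t : hom m n) s => (res t s.1, res t s.2)).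
- by move=> n [a b]; rewrite !res1.
- by move=> m n p g f [a b]; rewrite !resM.
Defined.

Definition discrete (A : Type) : sset :=
  @SetPresheaf Delta (fun=> A) (fun _ _ _ a => a)
    (fun _ _ => erefl) (fun _ _ _ _ _ _ => erefl).

Definition discrete_map (A B : Type) (f : A -> B) :
    smap (discrete A) (discrete B) :=
  @SetPresheafMap Delta (discrete A) (discrete B) (fun=> f)
    (fun _ _ _ _ => erefl).

Definition coface n (i : 'I_n.+2) : delta_map n n.+1.
Proof.
exists (fun j => lift i j) => j k jk.
by rewrite /= leq_bump2.
Defined.

(* A map from the horn with k-th face missing is a family (x i), i <> k, of
   n-simplices agreeing on all common faces. *)
Definition kan (X : sset) : Prop :=
  forall n (k : 'I_n.+2) (x : 'I_n.+2 -> X n),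
    (forall (i j : 'I_n.+2) m (a b : delta_map m n), i != k -> j != k ->
       delta_comp (coface i) a = delta_comp (coface j) b ->
       res (a : @hom Delta m n) (x i) = res (b : @hom Delta m n) (x j)) ->
  exists y : X n.+1, forall i, i != k ->
    res (coface i : @hom Delta n n.+1) y = x i.

Definition vertex (i : 'I_2) n : simplex 1 n :=
  @DeltaMap n 1 (fun=> i) (fun _ _ _ => leqnn i).

Definition homotopic (X Y : sset) (f g : smap X Y) : Prop :=
  exists H : smap (sprod X (simplex 1)) Y,
    (forall n (x : X n), H n (x, vertex ord0 n) = f n x) /\
    (forall n (x : X n), H n (x, vertex ord_max n) = g n x).

Definition homotopy_equivalence (X Y : sset) (f : smap X Y) : Prop :=
  exists g : smap Y X,
    homotopic (smap_comp g f) (smap_id X) /\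
    homotopic (smap_comp f g) (smap_id Y).

Record presheaf (C : category) := Presheaf {
  space :> C -> sset;
  restr : forall x y, hom x y -> smap (space y) (space x);
  restr1 : forall x n (s : space x n), restr (idm x) n s = s;
  restrM : forall x y z (g : hom y z) (f : hom x y) n (s : space z n),
    restr (g \oc f) n s = restr f n (restr g n s) }.

Record presheaf_map (C : category) (F G : presheaf C) := PresheafMap {
  pfun :> forall x, smap (F x) (G x);
  pfun_nat : forall x y (f : hom x y) n (s : F y n),
    pfun x n (restr F f n s) = restr G f n (pfun y n s) }.

Definition equivalence (C : category) (F G : presheaf C)
    (a : presheaf_map F G) : Prop :=
  forall x, homotopy_equivalence (a x).

Definition restriction (C : category) (P : C -> Prop) (F : presheaf C) :
    presheaf (full P) :=
  @Presheaf (full P) (fun x => F (sval x))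
    (fun x y (f : hom (sval x) (sval y)) => restr F f)
    (fun x => @restr1 C F (sval x)) (fun x y z g f => @restrM C F _ _ _ g f).

Section RightKanExtension.
Variables (C : category) (P : C -> Prop).
Local Notation D := (full P).

(* An m-simplex of the nerve of the category of factorizations x -> y -> t
   with y in D, i.e. of the two-sided bar construction B(D(x,-), D, C(-,t)).
   As x varies over D, this nerve is a projectively cofibrant resolution of the
   restriction to D of the presheaf represented by t. *)
Record chain (x : D) (t : C) (m : nat) := Chain {
  ch_ob : 'I_m.+1 -> D;
  ch_mor : forall i j : 'I_m.+1, (i <= j)%N -> hom (ch_ob i) (ch_ob j);
  ch_in : forall i, hom x (ch_ob i);
  ch_out : forall i, hom (sval (ch_ob i)) t;
  ch_mor1 : forall (i : 'I_m.+1) (ii : (i <= i)%N), ch_mor ii = idm (ch_ob i);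
  ch_morM : forall (i j k : 'I_m.+1) (ij : (i <= j)%N) (jk : (j <= k)%N) (ik : (i <= k)%N),
    ch_mor ik = ch_mor jk \oc ch_mor ij;
  ch_mor_in : forall (i j : 'I_m.+1) (ij : (i <= j)%N), ch_mor ij \oc ch_in i = ch_in j;
  ch_out_mor : forall (i j : 'I_m.+1) (ij : (i <= j)%N),
    ch_out j \oc (ch_mor ij : hom (sval (ch_ob i)) (sval (ch_ob j)))
      = ch_out i }.

Lemma chain_eq x t m ob mor
    (in1 in2 : forall i : 'I_m.+1, @hom D x (ob i))
    (out1 out2 : forall i : 'I_m.+1, hom (sval (ob i)) t) a b c d a' b' c' d' :
  (forall i, in1 i = in2 i) -> (forall i, out1 i = out2 i) ->
  @Chain x t m ob mor in1 out1 a b c d = @Chain x t m ob mor in2 out2 a' b' c' d'.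
Proof.
move=> e1 e2.
have {}e1 : in1 = in2 by apply: functional_extensionality_dep.
have {}e2 : out1 = out2 by apply: functional_extensionality_dep.
by subst; congr Chain; apply: Prop_irrelevance.
Qed.

Definition chain_act x t m p (th : delta_map m p) (w : chain x t p) :
    chain x t m.
Proof.
exists (fun i => ch_ob w (th i)) (fun i j ij => ch_mor w (dfun_mono th ij))
  (fun i => ch_in w (th i)) (fun i => ch_out w (th i)).
- by move=> *; apply: ch_mor1.
- by move=> *; apply: ch_morM.
- by move=> *; apply: ch_mor_in.
- by move=> *; apply: ch_out_mor.
Defined.

Definition chain_pre x x' t m (u : hom x' x) (w : chain x t m) : chain x' t m.
Proof.
exists (ch_ob w) (@ch_mor _ _ _ w) (fun i => ch_in w i \oc u) (ch_out w).
- by move=> *; apply: ch_mor1.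
- by move=> *; apply: ch_morM.
- by move=> i j ij; rewrite cmpA ch_mor_in.
- by move=> *; apply: ch_out_mor.
Defined.

Definition chain_post x t t' m (g : hom t t') (w : chain x t m) : chain x t' m.
Proof.
exists (ch_ob w) (@ch_mor _ _ _ w) (ch_in w) (fun i => g \oc ch_out w i).
- by move=> *; apply: ch_mor1.
- by move=> *; apply: ch_morM.
- by move=> *; apply: ch_mor_in.
- by move=> i j ij; rewrite -cmpA ch_out_mor.
Defined.

Variable F : presheaf D.

(* The value of the right Kan extension at t is the derived mapping space from
   the represented presheaf to F, i.e. the simplicial set of maps from the
   resolution above to F; this is the Bousfield-Kan formula for the homotopy
   limit of F over the objects of D over t. *)
Record ran_simplex (t : C) (n : nat) := RanSimplex {
  rfun :> forall (x : D) (m : nat), delta_map m n -> chain x t m -> F x m;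
  rfun_delta : forall x m p (th : delta_map m p) (s : delta_map p n)
    (w : chain x t p),
    rfun (delta_comp s th) (chain_act th w)
      = res (th : @hom Delta m p) (rfun s w);
  rfun_nat : forall x x' m (u : hom x' x) (s : delta_map m n)
    (w : chain x t m),
    rfun s (chain_pre u w) = restr F u m (rfun s w) }.

Lemma ran_simplex_eq t n (a b : ran_simplex t n) :
  (forall x m s (w : chain x t m), a x m s w = b x m s w) -> a = b.
Proof.
case: a b => [a a1 a2] [b b1 b2] /= e.
have {}e : a = b.
  do 4!(apply: functional_extensionality_dep => ?); exact: e.
by subst; congr RanSimplex; apply: Prop_irrelevance.
Qed.

Definition ran_act t n q (s : delta_map q n) (a : ran_simplex t n) :
    ran_simplex t q.
Proof.
exists (fun x m r w => a x m (delta_comp s r) w).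
- by move=> x m p th r w; rewrite -rfun_delta; congr rfun; apply: delta_map_eq.
- by move=> *; apply: rfun_nat.
Defined.

Definition ran_space (t : C) : sset.
Proof.
exists (ran_simplex t) (fun q n (s : delta_map q n) a => ran_act s a).
- move=> n a; apply: ran_simplex_eq => x m s w /=.
  by congr rfun; apply: delta_map_eq.
- move=> q n p g f a; apply: ran_simplex_eq => x m s w /=.
  by congr rfun; apply: delta_map_eq.
Defined.

Definition ran_post t t' n (g : hom t t') (a : ran_simplex t' n) :
    ran_simplex t n.
Proof.
exists (fun x m s w => a x m s (chain_post g w)).
- by move=> x m p th s w; rewrite -rfun_delta.
- by move=> x x' m u s w; rewrite -rfun_nat.
Defined.

Definition ran_restr t t' (g : hom t t') : smap (ran_space t') (ran_space t).
Proof.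
exists (fun n => @ran_post t t' n g) => q n s a.
exact: ran_simplex_eq.
Defined.

Definition ran : presheaf C.
Proof.
exists ran_space ran_restr.
- move=> t n a; apply: ran_simplex_eq => x m s w /=; congr rfun.
  by case: w => *; apply: chain_eq => // i; apply: cmp1m.
- move=> t t' t'' g f n a; apply: ran_simplex_eq => x m s w /=; congr rfun.
  by case: w => *; apply: chain_eq => // i /=; rewrite cmpA.
Defined.

End RightKanExtension.

Section Unit.
Variables (C : category) (O : presheaf C).

Definition chain_total (P : C -> Prop) (x : full P) t m (w : chain x t m) :
    hom (sval x) t :=
  ch_out w ord0 \oc (ch_in w ord0 : hom (sval x) (sval (ch_ob w ord0))).

Lemma chain_totalE (P : C -> Prop) (x : full P) t m (w : chain x t m) i :
  ch_out w i \oc (ch_in w i : hom (sval x) (sval (ch_ob w i))) = chain_total w.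
Proof.
have e : (@ord0 m <= i)%N by [].
rewrite /chain_total -(ch_out_mor w e) -(ch_mor_in w e) /=.
by rewrite cmpA.
Qed.

Section At.
Variable P : C -> Prop.

Definition unit_simplex t n (a : O t n) :
    ran_simplex (restriction P O) t n.
Proof.
exists (fun x m (s : delta_map m n) (w : chain x t m) =>
  restr O (chain_total w) m (res (s : @hom Delta m n) a)).
- move=> x m p th s w /=.
  rewrite (_ : delta_comp s th = (s : @hom Delta p n) \oc (th : @hom Delta m p)) //.
  by rewrite resM sfun_nat -(chain_totalE w (th ord0)).
- move=> x x' m u s w /=.
  by rewrite -restrM /chain_total /= cmpA.
Defined.

Definition unit_map t : smap (O t) (ran (restriction P O) t).
Proof.
exists (@unit_simplex t) => q n s a.
apply: ran_simplex_eq => x m r w /=.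
rewrite (_ : delta_comp s r = (s : @hom Delta q n) \oc (r : @hom Delta m q)) //.
by rewrite resM.
Defined.

Definition ran_unit : presheaf_map O (ran (restriction P O)).
Proof.
exists unit_map => t t' f n a.
apply: ran_simplex_eq => x m s w /=.
by rewrite -!sfun_nat -restrM /chain_total /= cmpA.
Defined.

End At.

Section Compare.
Variables (P Q : C -> Prop) (PQ : forall x, P x -> Q x).

Definition widen (x : full P) : full Q := exist Q (sval x) (PQ (svalP x)).

Definition chain_widen (x : full P) t m (w : chain x t m) :
  chain (widen x) t m := @Chain C Q (widen x) t m
    (fun i => widen (ch_ob w i)) (@ch_mor _ _ _ _ _ w) (ch_in w) (ch_out w)
    (@ch_mor1 _ _ _ _ _ w) (@ch_morM _ _ _ _ _ w) (@ch_mor_in _ _ _ _ _ w)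
    (@ch_out_mor _ _ _ _ _ w).

Definition compare_simplex t n (a : ran_simplex (restriction Q O) t n) :
    ran_simplex (restriction P O) t n.
Proof.
exists (fun x m s w => a (widen x) m s (chain_widen w)).
- move=> x m p th s w; exact: (rfun_delta a th s (chain_widen w)).
- move=> x x' m u s w.
  exact: (@rfun_nat _ _ _ _ _ a (widen x) (widen x') m u s (chain_widen w)).
Defined.

Definition compare_map t :
  smap (ran (restriction Q O) t) (ran (restriction P O) t).
Proof.
exists (@compare_simplex t) => q n s a.
exact: ran_simplex_eq.
Defined.

Definition ran_compare :
  presheaf_map (ran (restriction Q O)) (ran (restriction P O)).
Proof.
exists compare_map => t t' f n a.
exact: ran_simplex_eq.
Defined.

(* This characterizes ran_compare up to homotopy, by the universal property of
   the right Kan extension and full faithfulness of ran. *)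
Lemma ran_compare_unit t n (a : O t n) :
  ran_compare t n (ran_unit Q t n a) = ran_unit P t n a.
Proof. exact: ran_simplex_eq. Qed.

End Compare.
End Unit.

Local Open Scope order_scope.

(* The bottom element of a finBPOrderType is the root. *)
Record closed_tree := ClosedTree {
  tree_disp : Order.disp_t;
  edge :> finBPOrderType tree_disp;
  edge_linear : forall x y z : edge, y <= x -> z <= x -> y >=< z }.

(* An operad map Free(T) -> Free(U) is determined by its effect on edges, which
   can be any map as follows; the root need not be preserved. *)
Record tree_map (T U : closed_tree) := TreeMap {
  tfun :> T -> U;
  tfun_homo : forall x y, x <= y -> tfun x <= tfun y;
  tfun_indep : forall x y, x >< y -> tfun x >< tfun y }.

Lemma tree_map_eq T U (f g : tree_map T U) : f =1 g -> f = g.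
Proof.
case: f g => [f f1 f2] [g g1 g2] /= /funext e; subst g.
by congr TreeMap; apply: Prop_irrelevance.
Qed.

Definition tree_id T : tree_map T T :=
  @TreeMap T T (fun x => x) (fun _ _ h => h) (fun _ _ h => h).

Definition tree_comp T U V (g : tree_map U V) (f : tree_map T U) :
    tree_map T V :=
  @TreeMap T V (fun x => g (f x))
    (fun _ _ h => tfun_homo g (tfun_homo f h))
    (fun _ _ h => tfun_indep g (tfun_indep f h)).

Definition Omega_c : category.
Proof.
refine (@Category closed_tree tree_map tree_id tree_comp _ _ _) => *;
  exact: tree_map_eq.
Defined.

Definition vertex_inputs (T : closed_tree) (e : T) : {set T} :=
  [set x | (e < x) && [forall y, ~~ (e < y < x)]].

Definition dendroidal (k : nat) (T : Omega_c) : Prop :=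
  forall e : (T : closed_tree), (#|vertex_inputs e| <= k)%N.

Lemma dendroidalS k T : dendroidal k T -> dendroidal k.+1 T.
Proof. by move=> h e; apply: leqW. Qed.

Definition Omega_c_le (k : nat) : category := full (dendroidal k).

Definition Rk (k : nat) (O : presheaf Omega_c) : presheaf Omega_c :=
  ran (restriction (dendroidal k) O : presheaf (Omega_c_le k)).

Definition to_Rk (k : nat) (O : presheaf Omega_c) : presheaf_map O (Rk k O) :=
  ran_unit O (dendroidal k).

Definition Rk_step (k : nat) (O : presheaf Omega_c) :
    presheaf_map (Rk k.+1 O) (Rk k O) :=
  ran_compare O (@dendroidalS k).

(* For T closed, the operad Free(T) has a unique operation from a set S of
   distinct edges to e if S is an antichain of edges above e, and none
   otherwise. *)
Definition operation (T : closed_tree) (e : T) (S : {set T}) : bool :=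
  [forall x in S, e <= x] && [forall x in S, forall y in S, (x != y) ==> (x >< y)].

Definition linear_order_on (T : finType) (S : {set T}) (r : rel T) : Prop :=
  [/\ forall x y, r x y -> (x \in S) && (y \in S),
      {in S &, total r}, antisymmetric r & transitive r].

(* The value of A_infty at T is the set of operad maps from Free(T) to the
   associative operad (the dendroidal nerve): such a map sends each operation
   from S to e to a linear order on S, and composition to substitution. *)
Record assoc (T : closed_tree) := Assoc {
  aord :> T -> {set T} -> rel T;
  aord_linear : forall e S, operation e S -> linear_order_on S (aord e S);
  aord_junk : forall e S, ~~ operation e S -> forall x y, ~~ aord e S x y;
  aord_subst : forall e S (g : T -> {set T}), operation e S ->
    (forall s, s \in S -> operation s (g s)) ->
    forall s1 s2 x1 x2, s1 \in S -> s2 \in S -> x1 \in g s1 -> x2 \in g s2 ->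
    aord e (\bigcup_(s in S) g s) x1 x2
      = if s1 == s2 then aord s1 (g s1) x1 x2 else aord e S s1 s2 }.


Lemma assoc_eq T (a b : assoc T) :
  (forall e S x y, a e S x y = b e S x y) -> a = b.
Proof.
case: a b => [a a1 a2 a3] [b b1 b2 b3] /= e.
have {}e : a = b by do 4!(apply: functional_extensionality_dep => ?); exact: e.
by subst; congr Assoc; apply: Prop_irrelevance.
Qed.

Lemma operationP (T : closed_tree) (e : T) (S : {set T}) :
  reflect ((forall x, x \in S -> e <= x) /\
           (forall x y, x \in S -> y \in S -> x != y -> x >< y))
    (operation e S).
Proof.
apply: (iffP andP) => -[h1 h2]; split.
- by move=> x xS; move/forall_inP: h1; apply.
- move=> x y xS yS xy.
  by move/forall_inP: h2 => /(_ x xS)/forall_inP/(_ y yS)/implyP; apply.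
- exact/forall_inP.
- by apply/forall_inP => x xS; apply/forall_inP => y yS; apply/implyP; apply: h2.
Qed.

Lemma operation_bigcup (T : closed_tree) e (S : {set T}) (g : T -> {set T}) :
  operation e S -> (forall s, s \in S -> operation s (g s)) ->
  operation e (\bigcup_(s in S) g s).
Proof.
move=> /operationP[S1 S2] opg; apply/operationP; split.
  move=> x /bigcupP[s sS xs]; have /operationP[g1 _] := opg s sS.
  exact: le_trans (S1 s sS) (g1 x xs).
move=> x y /bigcupP[s sS xs] /bigcupP[t tS yt] xy.
have /operationP[gs gs'] := opg s sS; have /operationP[gt _] := opg t tS.
have [st|st] := eqVneq s t; first by apply: gs' => //; rewrite st.
apply: contra (S2 s t sS tS st) => /orP[xley|ylex].
  exact: (@edge_linear T y s t (le_trans (gs x xs) xley) (gt y yt)).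
exact: (@edge_linear T x s t (gs x xs) (le_trans (gt y yt) ylex)).
Qed.

Lemma operation_imset (T U : closed_tree) (f : tree_map T U) e S :
  operation e S -> operation (f e) (f @: S).
Proof.
move=> /operationP[h1 h2]; apply/operationP; split.
- by move=> _ /imsetP[x xS ->]; apply/tfun_homo/h1.
- move=> _ _ /imsetP[x xS ->] /imsetP[y yS ->] xy.
  apply/tfun_indep/h2 => //; apply: contraNneq xy => ->; exact: eqxx.
Qed.

Lemma operation_inj (T U : closed_tree) (f : tree_map T U) e S :
  operation e S -> {in S &, injective f}.
Proof.
move=> /operationP[_ h] x y xS yS fxy; apply/eqP/negPn/negP => xy.
by have := tfun_indep f (h _ _ xS yS xy); rewrite fxy comparablexx.
Qed.

(* On a closed corolla, these are the linear orderings of the set of maximal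
   edges. *)
Section Corolla.
Variable T : closed_tree.
Let S : {set T} := [set x | x != \bot].
Hypothesis corolla : forall x y, x \in S -> y \in S -> x != y -> x >< y.

Lemma corolla_leaf s x : s \in S -> s <= x -> x = s.
Proof.
rewrite inE => s0 sx; apply/eqP/negPn/negP => xs.
have x0 : x != \bot by apply: contraNneq s0 => x0; rewrite -lex0 -x0.
have xS : x \in S by rewrite inE.
have sS : s \in S by rewrite inE.
by have := corolla xS sS xs; rewrite /Order.comparable sx orbT.
Qed.

Lemma corolla_operation : operation \bot S.
Proof. by apply/operationP; split=> [x _|]; [apply: le0x | apply: corolla]. Qed.

Lemma corolla_inputs e (S' : {set T}) x y :
  operation e S' -> x \in S' -> y \in S' -> x != y ->
  [/\ e = \bot, x \in S & S' \subset S].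
Proof.
move=> /operationP[h1 h2] xS yS xy.
have nb a b : a \in S' -> b \in S' -> a != b -> a \in S.
  move=> aS bS ab; rewrite inE; apply: contra (h2 a b aS bS ab) => /eqP->.
  by rewrite /Order.comparable le0x.
have xS' := nb x y xS yS xy; split=> //.
  apply/eqP/negPn/negP => e0; have eS : e \in S by rewrite inE.
  case/eqP: xy.
  by rewrite (corolla_leaf eS (h1 x xS)) (corolla_leaf eS (h1 y yS)).
apply/subsetP => z zS; have [->//|zx] := eqVneq z x.
exact: nb zx.
Qed.

Lemma assoc_corolla_inj (a b : assoc T) : a \bot S = b \bot S -> a = b.
Proof.
move=> ab; apply: assoc_eq => e S' x y.
have [opS|opS] := boolP (operation e S'); last first.
  by rewrite (negPf (aord_junk a opS x y)) (negPf (aord_junk b opS x y)).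
have [a1 a2 _ _] := aord_linear a opS; have [b1 b2 _ _] := aord_linear b opS.
have [xyS|xyS] := boolP ((x \in S') && (y \in S')); last first.
  by apply/idP/idP => [/a1|/b1]; rewrite (negPf xyS).
have /andP[xS yS] := xyS.
have [<-|xy] := eqVneq x y.
  by have := a2 x x xS xS; have := b2 x x xS xS; rewrite !orbb => -> ->.
have [-> _ sS] := corolla_inputs opS xS yS xy.
pose g s := if s \in S' then [set s] else set0 : {set T}.
have opg s : s \in S -> operation s (g s).
  move=> _; apply/operationP; rewrite /g; case: ifP => _.
    split=> [z /set1P-> //|z w /set1P-> /set1P->].
    by rewrite eqxx.
  by split=> [z|z w]; rewrite inE.
have gS : \bigcup_(s in S) g s = S'.
  apply/setP => z; apply/bigcupP/idP => [[s _]|zS].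
    by rewrite /g; case: ifP => [sS'|_]; rewrite inE // => /eqP->.
  by exists z; [apply: (subsetP sS) | rewrite /g zS inE].
have gx z : z \in S' -> z \in g z by move=> zS; rewrite /g zS inE.
have xS' := subsetP sS x xS; have yS' := subsetP sS y yS.
rewrite -gS (aord_subst a corolla_operation opg xS' yS' (gx x xS) (gx y yS)).
rewrite (aord_subst b corolla_operation opg xS' yS' (gx x xS) (gx y yS)).
by rewrite (negPf xy) ab.
Qed.

Lemma assoc_corolla_surj (r : rel T) :
  linear_order_on S r -> exists a : assoc T, a \bot S = r.
Proof.
move=> [r1 r2 r3 r4].
pose o (e : T) (S' : {set T}) x y :=
  [&& operation e S', x \in S', y \in S' & (x == y) || r x y].
have @a : assoc T.
  exists o.
  - move=> e S' opS; split=> [x y /and4P[_ -> ->]//|x y xS yS|x y|y x z].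
    + rewrite /o opS xS yS /= [y == x]eq_sym.
      have [//|xy] := eqVneq x y.
      have [_ xS' sS] := corolla_inputs opS xS yS xy.
      by apply: r2 => //; apply: (subsetP sS).
    + move=> /andP[/and4P[_ _ _ xy] /and4P[_ _ _ yx]].
      case/orP: xy => [/eqP//|xy]; case/orP: yx => [/eqP//|yx].
      by apply: r3; rewrite xy.
    + move=> /and4P[_ xS _ xy] /and4P[_ _ zS yz]; rewrite /o opS xS zS /=.
      case/orP: xy => [/eqP->//|xy].
      case/orP: yz => [/eqP<-|yz]; first by rewrite xy orbT.
      by rewrite (r4 _ _ _ xy yz) orbT.
  - by move=> e S' opS x y; rewrite /o (negPf opS).
  - move=> e S' g opS opg s1 s2 x1 x2 s1S s2S x1g x2g.
    have inU s x : s \in S' -> x \in g s -> x \in \bigcup_(s in S') g s.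
      by move=> sS xs; apply/bigcupP; exists s.
    rewrite /o operation_bigcup // (inU s1) // (inU s2) //= opS s1S s2S /=.
    have [e12|s12] := eqVneq s1 s2; first by rewrite opg // x1g e12 x2g.
    have [_ _ /subsetP sS] := corolla_inputs opS s1S s2S s12.
    have /operationP[g1 _] := opg s1 s1S; have /operationP[g2 _] := opg s2 s2S.
    rewrite (corolla_leaf (sS _ s1S) (g1 _ x1g)).
    by rewrite (corolla_leaf (sS _ s2S) (g2 _ x2g)) (negPf s12).
exists a; apply/funext => x; apply/funext => y; rewrite /= /o corolla_operation /=.
apply/and3P/idP => [[xS yS /orP[/eqP->|//]]|rxy].
  by have := r2 y y yS yS; rewrite orbb.
by have /andP[-> ->] := r1 _ _ rxy; rewrite rxy orbT.
Qed.

End Corolla.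

Section AssocRestriction.
Variables (T U : closed_tree) (f : tree_map T U) (a : assoc U).

Definition assoc_ord (e : T) (S : {set T}) (x y : T) : bool :=
  [&& operation e S, x \in S, y \in S & a (f e) (f @: S) (f x) (f y)].

Definition assoc_act : assoc T.
Proof.
exists assoc_ord.
- move=> e S opS; have [l1 l2 l3 l4] := aord_linear a (operation_imset f opS).
  split=> [x y /and4P[_ -> ->]//|x y xS yS|x y|y x z].
  + by rewrite /assoc_ord opS xS yS /=; apply: l2; apply: imset_f.
  + move=> /andP[/and4P[_ xS yS xy] /and4P[_ _ _ yx]].
    by apply: (operation_inj (f := f) opS) => //; apply: l3; apply/andP; split.
  + move=> /and4P[_ xS yS xy] /and4P[_ _ zS yz].
    by rewrite /assoc_ord opS xS zS; apply: l4 yz.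
- by move=> e S opS x y; rewrite /assoc_ord (negPf opS).
- move=> e S g opS opg s1 s2 x1 x2 s1S s2S x1g x2g.
  have opU := operation_bigcup opS opg.
  have inU s x : s \in S -> x \in g s -> x \in \bigcup_(s in S) g s.
    by move=> sS xs; apply/bigcupP; exists s.
  pose g' (u : U) := \bigcup_(s in S | f s == u) (f @: g s).
  have g'E s : s \in S -> g' (f s) = f @: g s.
    move=> sS; rewrite /g' (big_pred1 s) // => t.
    apply/andP/eqP => [[tS /eqP fts]|->]; last by rewrite sS eqxx.
    exact: (operation_inj (f := f) opS).
  have fU : f @: (\bigcup_(s in S) g s) = \bigcup_(u in f @: S) g' u.
    apply/setP => u; apply/imsetP/bigcupP.
      move=> [x /bigcupP[s sS xs] ->]; exists (f s); first exact: imset_f.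
      by rewrite g'E //; apply: imset_f.
    move=> [_ /imsetP[s sS ->]]; rewrite g'E // => /imsetP[x xs ->].
    by exists x => //; apply: inU xs.
  have opg' u : u \in f @: S -> operation u (g' u).
    by move=> /imsetP[s sS ->]; rewrite g'E //; apply/operation_imset/opg.
  rewrite /assoc_ord opU (inU s1) // (inU s2) //= fU.
  rewrite (@aord_subst _ a (f e) (f @: S) g' (operation_imset f opS) opg' (f s1) (f s2))
    ?imset_f ?g'E ?imset_f //.
  rewrite (inj_in_eq (operation_inj (f := f) opS)) // opS s1S s2S /=.
  by have [e12|//] := eqVneq s1 s2; rewrite opg // x1g e12 x2g.
Defined.

End AssocRestriction.

Definition A_infty : presheaf Omega_c.
Proof.
exists (fun T : Omega_c => discrete (assoc T))
  (fun (T U : Omega_c) (f : hom T U) => discrete_map (assoc_act f)).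
- move=> T n a; apply: assoc_eq => e S x y /=.
  rewrite /assoc_ord /= imset_id.
  have [opS|opS] := boolP (operation e S); last first.
    by rewrite (negPf (aord_junk a opS x y)).
  have [l _ _ _] := aord_linear a opS.
  by rewrite /=; apply/and3P/idP => [[]|axy] //; have /andP[] := l _ _ axy.
- move=> T U V g f n a; apply: assoc_eq => e S x y /=.
  rewrite /assoc_ord /= /assoc_ord /=.
  have [opS|//] := boolP (operation e S).
  have [xS|//] := boolP (x \in S); have [yS|//] := boolP (y \in S).
  by rewrite (operation_imset f opS) !imset_f //= -imset_comp.
Defined.

Definition E_infty : presheaf Omega_c :=
  @Presheaf Omega_c (fun=> discrete unit) (fun _ _ _ => smap_id (discrete unit))
    (fun _ _ _ => erefl) (fun _ _ _ _ _ _ _ => erefl).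

Lemma kan_discrete (A : Type) : kan (discrete A).
Proof.
move=> n k x compat; have ij i j : i != k -> j != k -> x i = x j.
  move=> ik jk; have [a ak _] := unlift_some ik; have [b bk _] := unlift_some jk.
  apply: (compat i j 0 (@DeltaMap 0 n (fun=> a) (fun _ _ _ => leqnn a))
                       (@DeltaMap 0 n (fun=> b) (fun _ _ _ => leqnn b))) => //.
  by apply: delta_map_eq => l /=; rewrite -ak -bk.
have /existsP[i0 i0k] : [exists i, i != k].
  by apply/existsP; exists (lift k ord0); rewrite eq_sym neq_lift.
by exists (x i0) => i ik; apply: ij.
Qed.

(* So the ran of a restriction of A_infty is its homotopy right Kan extension. *)
Lemma kan_A_infty T : kan (A_infty T).
Proof. exact: kan_discrete. Qed.

(* Main.v *)
(* For x in a full subcategory D, the category of factorizations x -> y -> t of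
   a fixed x -> t through D has an initial object, so a simplex of the derived
   right Kan extension of the discrete A_infty is just a natural family of
   elements psi_f of A_infty(x), indexed by the maps f : x -> t with x in D.

   An element of A_infty(T) amounts to a "planar structure": a relation ordering
   each pair of incomparable edges, transitive on triples of pairwise
   incomparable edges and invariant under going up in the tree. Each of these
   axioms can be checked on closed subtrees spanned by at most three edges
   besides the root, which are 3-dendroidal. So for k >= 3 the natural families
   glue uniquely. The trees with all valences at most 1 are linear and carry a
   unique planar structure, whence the case k = 1. *)

Require Import Defs.
From HB Require Import structures.
#[warnings="-notation-overridden"]
From mathcomp Require Import all_boot all_order.
From mathcomp Require Import boolp.

Set Implicit Arguments.
Unset Strict Implicit.
Unset Printing Implicit Defensive.

Import Order.TTheory.
Local Open Scope cat_scope.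
Local Open Scope order_scope.

(** * Elements of [assoc T] as planar structures on incomparable pairs *)

Section Assoc.
Variable T : closed_tree.
Implicit Types (x y : T) (a b : assoc T).

Lemma incomparable_neq x y : x >< y -> x != y.
Proof. by apply: contraNneq => ->; rewrite comparablexx. Qed.

Lemma incomparableC x y : (x >< y) = (y >< x).
Proof. by rewrite comparable_sym. Qed.

(** If [y1] and [y2] were comparable, [x1] and [x2] would both lie below the larger one, and the
    edges below an edge form a chain. *)
Lemma incomparable_le x1 x2 y1 y2 :
  x1 >< x2 -> x1 <= y1 -> x2 <= y2 -> y1 >< y2.
Proof.
move=> x12 le1 le2; apply: contra x12 => /orP[y12|y21].
  exact: (@edge_linear T y2 x1 x2 (le_trans le1 y12) le2).
exact: (@edge_linear T y1 x1 x2 le1 (le_trans le2 y21)).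
Qed.

Lemma operation_pair x y : x >< y -> operation \bot [set x; y].
Proof.
move=> xy; apply/operationP; split=> [z _|u v]; first exact: le0x.
by move=> /set2P[]-> /set2P[]->; rewrite ?eqxx // incomparableC.
Qed.

Definition planar_order a x y := a \bot [set x; y] x y.

(** Substituting nullary operations for the inputs other than [x] and [y] shrinks [S] to the pair;
    composing with the unary operation from [e] to the root then moves the output to [\bot]. *)
Lemma aord_pair a e S x y : operation e S -> x \in S -> y \in S -> x != y ->
  a e S x y = planar_order a x y.
Proof.
move=> opS xS yS xy; rewrite /planar_order.
have /operationP[S1 S2] := opS.
pose g s := if s \in [set x; y] then [set s] else set0 : {set T}.
have opg s : s \in S -> operation s (g s).
  move=> _; apply/operationP; rewrite /g; case: ifP => _.
    split=> [z /set1P-> //|z w /set1P-> /set1P->].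
    by rewrite eqxx.
  by split=> [z|z w]; rewrite inE.
have gS : \bigcup_(s in S) g s = [set x; y].
  apply/setP => z; apply/bigcupP/idP => [[s _]|zS].
    by rewrite /g; case: ifP => [sS'|_]; rewrite inE // => /eqP->.
  by exists z; [case/set2P: zS => -> // | rewrite /g zS inE].
have xg : x \in g x by rewrite /g set21 set11.
have yg : y \in g y by rewrite /g set22 set11.
have := aord_subst a opS opg xS yS xg yg.
rewrite gS (negPf xy) => <-.
have op1 : operation \bot [set e].
  by apply/operationP; split=> [*|u v /set1P-> /set1P->]; rewrite ?le0x ?eqxx.
have op2 s : s \in [set e] -> operation s [set x; y].
  move=> /set1P->; apply/operationP.
  split=> [z /set2P[]->|z w /set2P[]-> /set2P[]->]; try exact: S1.
  - by rewrite eqxx.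
  - by move=> _; apply: S2.
  - by move=> yx; apply: S2.
  - by rewrite eqxx.
have := @aord_subst T a _ _ (fun=> [set x; y]) op1 op2 e e x y.
by rewrite big_set1 eqxx !inE !eqxx orbT => ->.
Qed.

Definition planar (r : rel T) : Prop :=
  [/\ forall x y, x >< y -> r x y = ~~ r y x,
      forall x y z, x >< y -> y >< z -> x >< z -> r x y -> r y z -> r x z
    & forall s1 s2 x1 x2, s1 >< s2 -> s1 <= x1 -> s2 <= x2 ->
        r x1 x2 = r s1 s2].

Lemma planar_order_planar a : planar (planar_order a).
Proof.
split=> [x y xy|x y z xy yz xz|s1 s2 x1 x2 s12 sx1 sx2].
- have [_ l2 l3 _] := aord_linear a (operation_pair xy).
  have := l2 x y; have := l3 x y.
  rewrite /planar_order [X in a _ X y x]setUC !inE !eqxx orbT.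
  case: (a _ _ x y); case: (a _ _ y x) => //=.
    by move=> /(_ isT) e; rewrite e comparablexx in xy.
  by move=> _ /(_ isT isT).
- have opS : operation \bot [set x; y; z].
    apply/operationP; split=> [u _|u v]; first exact: le0x.
    rewrite !inE => /orP[/orP[]|] /eqP-> /orP[/orP[]|] /eqP->;
      by rewrite ?eqxx // incomparableC.
  have [_ _ _ l4] := aord_linear a opS.
  rewrite -!(aord_pair a opS) ?inE ?eqxx ?orbT //; try exact: incomparable_neq.
  exact: l4.
- have opS := operation_pair s12; have ns := incomparable_neq s12.
  (* Invariance is substitution of the unary operations from [x1] to [s1] and from [x2] to [s2]. *)
  pose g s := [set if s == s1 then x1 else x2].
  have opg s : s \in [set s1; s2] -> operation s (g s).
    move=> sS; apply/operationP; split=> [u /set1P->|u v /set1P-> /set1P->].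
      case/set2P: sS => ->; first by rewrite eqxx.
      by rewrite eq_sym (negPf ns).
    by rewrite eqxx.
  have x12 := incomparable_neq (incomparable_le s12 sx1 sx2).
  have xg1 : x1 \in g s1 by rewrite /g eqxx inE.
  have xg2 : x2 \in g s2 by rewrite /g eq_sym (negPf ns) inE.
  have sS1 : s1 \in [set s1; s2] by rewrite !inE eqxx.
  have sS2 : s2 \in [set s1; s2] by rewrite !inE eqxx orbT.
  have := aord_subst a opS opg sS1 sS2 xg1 xg2.
  rewrite (negPf ns) (aord_pair a (operation_bigcup opS opg)) //.
    by apply/bigcupP; exists s1.
  by apply/bigcupP; exists s2.
Qed.

(** Distinct inputs of an operation are incomparable, so [aord_pair] applies off the diagonal; on
    the diagonal, totality forces reflexivity. *)
Lemma assoc_planar_inj a b :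
  (forall x y, x >< y -> planar_order a x y = planar_order b x y) -> a = b.
Proof.
move=> ab; apply: assoc_eq => e S x y.
have [opS|opS] := boolP (operation e S); last first.
  by rewrite (negPf (aord_junk a opS x y)) (negPf (aord_junk b opS x y)).
have [a1 a2 _ _] := aord_linear a opS; have [b1 b2 _ _] := aord_linear b opS.
have [/andP[xS yS]|xyS] := boolP ((x \in S) && (y \in S)); last first.
  by apply/idP/idP => [/a1|/b1]; rewrite (negPf xyS).
have [<-|xy] := eqVneq x y.
  by have := a2 x x xS xS; have := b2 x x xS xS; rewrite !orbb => -> ->.
rewrite !aord_pair //; apply: ab.
by have /operationP[_ ->] := opS.
Qed.

Section AssocOfPlanar.
Variable r : rel T.
Hypothesis rP : planar r.

(** [planar] leaves [r] free on the diagonal, hence the disjunct [x == y]. *)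
Definition assoc_of_planar_ord (e : T) (S : {set T}) x y :=
  [&& operation e S, x \in S, y \in S & (x == y) || r x y].

Definition assoc_of_planar : assoc T.
Proof.
exists assoc_of_planar_ord; rewrite /assoc_of_planar_ord;
  have [r1 r2 r3] := rP.
- move=> e S opS; have /operationP[_ S2] := opS.
  split=> [x y /and4P[_ -> ->]//|x y xS yS|x y|y x z].
  + rewrite opS xS yS /= [y == x]eq_sym.
    have [//|xy] := eqVneq x y; rewrite (r1 x y) ?orNb //.
    exact: S2.
  + move=> /andP[/and4P[_ xS yS xy] /and4P[_ _ _ yx]].
    have [//|nxy] := eqVneq x y; move: xy yx.
    rewrite [y == x]eq_sym (negPf nxy) /= (r1 x y) ?S2 //.
    by move=> /negPf->.
  + move=> /and4P[_ xS yS xy] /and4P[_ _ zS yz]; rewrite opS xS zS /=.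
    have [//|nxz] := eqVneq x z.
    case: (eqVneq x y) yz xy => [<-|nxy]; first by rewrite (negPf nxz).
    case: (eqVneq y z) => [<-|nyz] //= yz xy.
    by apply: r2 xy yz; apply: S2.
- by move=> e S opS x y; rewrite (negPf opS).
- move=> e S g opS opg s1 s2 x1 x2 s1S s2S x1g x2g.
  have inU s x : s \in S -> x \in g s -> x \in \bigcup_(s in S) g s.
    by move=> sS xs; apply/bigcupP; exists s.
  rewrite operation_bigcup // (inU s1) // (inU s2) //= opS s1S s2S /=.
  have [e12|ns12] := eqVneq s1 s2; first by rewrite opg // x1g e12 x2g.
  have /operationP[_ S2] := opS.
  have /operationP[g1 _] := opg s1 s1S; have /operationP[g2 _] := opg s2 s2S.
  (* Inputs from different blocks lie above incomparable edges, so the substitution law becomes the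
     invariance of [r]. *)
  have s12 := S2 _ _ s1S s2S ns12.
  have := incomparable_neq (incomparable_le s12 (g1 _ x1g) (g2 _ x2g)).
  by move=> /negPf->; apply: r3; rewrite ?g1 ?g2.
Defined.

Lemma planar_order_assoc_of_planar x y :
  x >< y -> planar_order assoc_of_planar x y = r x y.
Proof.
move=> xy; rewrite /planar_order /= /assoc_of_planar_ord operation_pair //.
by rewrite !inE !eqxx orbT (negPf (incomparable_neq xy)).
Qed.

End AssocOfPlanar.
End Assoc.

(** [f] may move the root, so the operation obtained in [U] has output [f \bot]; [aord_pair] resets
    it to [\bot]. *)
Lemma planar_order_act (T U : closed_tree) (f : tree_map T U) (a : assoc U)
    x y :
  x >< y -> planar_order (assoc_act f a) x y = planar_order a (f x) (f y).
Proof.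
move=> xy; rewrite {1}/planar_order /= /assoc_ord operation_pair //.
have opf := operation_imset f (operation_pair xy).
rewrite !inE !eqxx orbT /= (aord_pair a opf) ?imset_f ?inE ?eqxx ?orbT //.
exact/incomparable_neq/tfun_indep.
Qed.

(** * Closed subtrees spanned by a set of edges *)

Section Subtree.
Variables (T : closed_tree) (A : {set T}).

(** Adding the root gives the induced order a least element for every [A]. *)
Record subtree_edge := SubtreeEdge {
  subtree_val : T;
  subtree_valP : subtree_val \in \bot |: A }.

HB.instance Definition _ := [isSub for subtree_val].
HB.instance Definition _ := [Finite of subtree_edge by <:].
HB.instance Definition _ :=
  [SubChoice_isSubPOrder of subtree_edge by <: with tree_disp T].

Definition subtree_bot : subtree_edge := SubtreeEdge (setU11 \bot A).

Lemma subtree_le0x (x : subtree_edge) : subtree_bot <= x.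
Proof. by rewrite -Order.le_val le0x. Qed.

HB.instance Definition _ :=
  Order.hasBottom.Build (tree_disp T) subtree_edge subtree_le0x.

Definition subtree : closed_tree.
Proof.
apply: (@ClosedTree (tree_disp T) subtree_edge) => x y z.
rewrite /Order.comparable -!Order.le_val; exact: edge_linear.
Defined.

Definition subtree_pt (x : T) (xA : x \in A) : subtree :=
  SubtreeEdge (setU1r \bot xA).

(** An input lies strictly above some edge, so it is not the root and belongs to [A]. *)
Lemma subtree_dendroidal k : (#|A| <= k)%N -> dendroidal k subtree.
Proof.
move=> Ak e; apply: leq_trans Ak.
rewrite -(card_imset _ (val_inj : injective subtree_val)).
apply/subset_leq_card/subsetP => _ /imsetP[x + ->].
rewrite inE => /andP[ex _]; have := subtree_valP x.
rewrite in_setU1 => /orP[/eqP x0|//].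
by move: ex; rewrite -Order.SubPreorderTheory.lt_val /= x0 ltx0.
Qed.

Definition subtree_incl : tree_map subtree T.
Proof.
exists (fun x : subtree => subtree_val x) => x y.
  by rewrite -Order.le_val.
by rewrite /Order.comparable -!Order.le_val.
Defined.

Lemma subtree_incl_incomparable (x y : subtree) :
  (subtree_incl x >< subtree_incl y) = (x >< y).
Proof. by rewrite /Order.comparable -!Order.le_val. Qed.

Lemma subtree_lift (X : closed_tree) (f : tree_map X T) :
  (forall x, f x \in \bot |: A) ->
  exists g : tree_map X subtree, tree_comp subtree_incl g = f.
Proof.
move=> fA.
have @g : tree_map X subtree.
  exists (fun x => SubtreeEdge (fA x) : subtree) => x y xy.
    by rewrite -Order.le_val /=; apply: tfun_homo.
  by rewrite /Order.comparable -!Order.le_val /=; apply: tfun_indep.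
by exists g; apply: tree_map_eq.
Qed.

End Subtree.

(** * Trees with all valences at most one *)

Section LinearTree.
Variable T : closed_tree.
Hypothesis T1 : dendroidal 1 (T : Omega_c).

Lemma vertex_input_below (e u : T) :
  e < u -> exists2 x, x \in vertex_inputs e & x <= u.
Proof.
move=> eu; have Pu : (e < u) && (u <= u) by rewrite eu lexx.
(* Among the edges above [e] and up to [u], one with the fewest edges strictly below it is minimal
   over [e]. *)
case: (@arg_minnP _ u (fun y : T => (e < y) && (y <= u))
  (fun y => #|[set z : T | z < y]|) Pu) => x /andP[ex xu] xmin.
exists x => //; rewrite inE ex; apply/forallP => y; apply/negP => /andP[ey yx].
have := xmin y; rewrite ey (le_trans (ltW yx) xu) => /(_ isT).
rewrite leqNgt => /negP; apply; apply: proper_card; apply/properP; split.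
  by apply/subsetP => z; rewrite !inE => zy; apply: lt_trans yx.
by exists y; rewrite !inE ?ltxx.
Qed.

(* A maximal common lower bound of two incomparable edges would have valence at
   least two. *)
Lemma dendroidal1_comparable (u v : T) : u >=< v.
Proof.
apply/negPn/negP => uv.
have P0 : ((\bot : T) <= u) && ((\bot : T) <= v) by rewrite !le0x.
case: (@arg_maxnP _ \bot (fun y : T => (y <= u) && (y <= v))
  (fun y => #|[set z : T | z <= y]|) P0) => e /andP[eu ev] emax.
have ltu : e < u.
  rewrite lt_neqAle eu andbT; apply: contraNneq uv => <-.
  by rewrite /Order.comparable ev.
have ltv : e < v.
  rewrite lt_neqAle ev andbT; apply: contraNneq uv => <-.
  by rewrite /Order.comparable eu orbT.
have [x xe xu] := vertex_input_below ltu.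
have [y ye yv] := vertex_input_below ltv.
(* The single input of [e] lies below both [u] and [v], against the choice of [e]. *)
have /card_le1_eqP/(_ _ _ xe ye) xy := T1 e.
have xv : x <= v by rewrite -xy.
have := emax x; rewrite xu xv => /(_ isT).
rewrite /= leqNgt => /negP; apply.
have ex : e < x by move: xe; rewrite inE => /andP[].
apply: proper_card; apply/properP; split.
  by apply/subsetP => z; rewrite !inE => ze; apply: le_trans ze (ltW ex).
by exists x; rewrite !inE ?lexx // lt_geF.
Qed.

End LinearTree.

(** The inverse exists by choice, injectivity of [f] makes it natural, and both composites are
    identities, so constant homotopies suffice. *)
Lemma bijective_homotopy_equivalence (X Y : sset) (f : smap X Y) :
  (forall n, injective (f n)) -> (forall n y, exists x, f n x = y) ->
  homotopy_equivalence f.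
Proof.
move=> f_inj f_surj.
pose g0 n y := sval (cid (f_surj n y)).
have fg n y : f n (g0 n y) = y by rewrite /g0; case: cid.
have g0_nat m n (t : hom m n) y : g0 m (res t y) = res t (g0 n y).
  by apply: f_inj; rewrite fg sfun_nat fg.
pose g : smap Y X := SetPresheafMap g0_nat.
have homotopic_id (Z : sset) (h : smap Z Z) :
    (forall n z, h n z = z) -> homotopic h (smap_id Z).
  move=> hz; have @H : smap (sprod Z (simplex 1)) Z by exists (fun n z => z.1).
  by exists H; split=> // n z; rewrite hz.
exists g; split; apply: homotopic_id => n z /=; last exact: fg.
by apply: f_inj; rewrite fg.
Qed.

(** * Chains joining a factorization to the initial one *)

Section Chain.
Variables (C : category) (P : C -> Prop).
Variables (x : full P) (t : C).

Lemma chain_eq_mor m ob mor mor' inn out a b c d a' b' c' d' :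
  (forall i j ij, mor i j ij = mor' i j ij) ->
  @Chain C P x t m ob mor inn out a b c d
    = @Chain C P x t m ob mor' inn out a' b' c' d'.
Proof.
move=> e; have {}e : mor = mor'.
  by do 3!(apply: functional_extensionality_dep => ?); apply: e.
by subst; congr Chain; apply: Prop_irrelevance.
Qed.

Definition unit_chain m (f : hom (sval x) t) : chain x t m.
Proof.
exists (fun=> x) (fun _ _ _ => idm x) (fun=> idm x) (fun=> f) => *;
  rewrite ?cmp1m //; exact: (@cmpm1 C).
Defined.

Section Factorization.
Variables (y : full P) (u : hom x y) (f : hom (sval y) t).

(** Indexing by [nat] rather than ['I_2] lets a match on the index compute; every positive index
    stands for [y]. *)
Definition factor_ob (i : nat) : full P := if i is 0 then x else y.

Definition factor_mor (i j : nat) :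
    (i <= j)%N -> hom (factor_ob i) (factor_ob j) :=
  match i, j return (i <= j)%N -> hom (factor_ob i) (factor_ob j) with
  | 0, 0 => fun=> idm x
  | 0, _.+1 => fun=> u
  | _.+1, 0 => fun ij => False_rect _ (notF ij)
  | _.+1, _.+1 => fun=> idm y
  end.

Definition factor_in (i : nat) : hom x (factor_ob i) :=
  match i return hom x (factor_ob i) with 0 => idm x | _.+1 => u end.

Definition factor_out (i : nat) : hom (sval (factor_ob i)) t :=
  match i return hom (sval (factor_ob i)) t with
  | 0 => f \oc (u : hom (sval x) (sval y)) | _.+1 => f end.

(* The edge from the initial factorization [x = x -> t] to [x -> y -> t]. *)
Definition factor_chain : chain x t 1.
Proof.
exists (fun i => factor_ob i) (fun i j => @factor_mor i j)
  (fun i => factor_in i) (fun i => factor_out i).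
- by move=> [[|i] ?].
- by move=> [[|i] ?] [[|j] ?] [[|k] ?] //= *; rewrite (cmp1m, cmpm1) ?cmpm1.
- by move=> [[|i] ?] [[|j] ?] //= *; rewrite (cmp1m, cmpm1) ?cmpm1.
- by move=> [[|i] ?] [[|j] ?] //= *; exact: (@cmpm1 C).
Defined.

End Factorization.
End Chain.

Definition delta_vertex n (i : 'I_n.+1) : delta_map 0 n :=
  @DeltaMap 0 n (fun=> i) (fun _ _ _ => leqnn i).

(** * Simplices of the right Kan extension as natural families *)

Section RanAssoc.
Variables (P : Omega_c -> Prop) (T : Omega_c).
Local Notation D := (full P).
Local Notation ranA := (ran (restriction P A_infty)).

Definition ran_value n (a : ranA T n) (x : D) (f : hom (sval x) T) :
    assoc (sval x) :=
  (a : ran_simplex (restriction P A_infty) T n) x 0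
    (delta_vertex ord0) (unit_chain 0 f).

(** By discreteness a simplex is determined by any of its vertices, and the two ends of an edge
    agree. The edge [W] joins the unit chain on the total map to vertex [0] of [w]. *)
Lemma ran_valueE n (a : ranA T n) (x : D) m (s : delta_map m n)
    (w : chain x T m) :
  (a : ran_simplex (restriction P A_infty) T n) x m s w
    = ran_value a (chain_total w).
Proof.
(* [s'] is the edge from vertex [0] to vertex [s ord0] of the [n]-simplex, matching the two ends of
   [W]. *)
have s'P (i j : 'I_2) :
    (i <= j)%N -> ((if val i == 0 then ord0 else s ord0) <=
                   (if val j == 0 then ord0 else s ord0))%N.
  by case: i j => [[|i] ?] [[|j] ?] /=.
pose s' : delta_map 1 n := DeltaMap s'P.
pose W : chain x T 1 := factor_chain (ch_in w ord0) (ch_out w ord0).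
pose v0 : delta_map 0 1 := delta_vertex ord0.
pose v1 : delta_map 0 1 := delta_vertex ord_max.
pose th : delta_map 0 m := delta_vertex ord0.
have Ew := rfun_delta a th s w.
have E0 := rfun_delta a v0 s' W.
have E1 := rfun_delta a v1 s' W.
rewrite -[LHS]Ew.
have -> : delta_comp s th = delta_comp s' v1 by apply: delta_map_eq.
have -> : chain_act th w = chain_act v1 W.
  by apply: chain_eq_mor => i j ij /=; rewrite ch_mor1.
rewrite [LHS]E1 -[LHS]E0 /ran_value.
have -> : delta_comp s' v0 = delta_vertex ord0 by apply: delta_map_eq.
have -> // : chain_act v0 W = unit_chain 0 (chain_total w).
exact: chain_eq_mor.
Qed.

Lemma ran_value_nat n (a : ranA T n) (x x' : D) (u : hom x' x)
    (f : hom (sval x) T) :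
  ran_value a (f \oc (u : hom (sval x') (sval x)))
    = assoc_act (u : tree_map (sval x') (sval x)) (ran_value a f).
Proof.
have E := rfun_nat a u (delta_vertex ord0) (unit_chain 0 f).
(* The precomposed chain is not the unit chain on the composite, but it has the same total map. *)
rewrite ran_valueE in E.
rewrite -[RHS]E /chain_total /= [tree_comp (tree_id _) u](@cmp1m Omega_c).
by [].
Qed.

Lemma ran_value_inj n (a b : ranA T n) :
  (forall (x : D) (f : hom (sval x) T), ran_value a f = ran_value b f) -> a = b.
Proof.
by move=> ab; apply: ran_simplex_eq => x m s w; rewrite !ran_valueE ab.
Qed.

(** Compatibility with faces and degeneracies holds because, by [chain_totalE], all vertices of a
    chain have the same total map. *)
Definition ran_of_family n
    (psi : forall x : D, hom (sval x) T -> assoc (sval x))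
    (psi_nat : forall (x x' : D) (u : hom x' x) (f : hom (sval x) T),
      psi x' (f \oc (u : hom (sval x') (sval x)))
        = assoc_act (u : tree_map (sval x') (sval x)) (psi x f)) : ranA T n.
Proof.
exists (fun x m _ w => psi x (chain_total w)).
- by move=> x m p th s w /=; congr psi; apply: (chain_totalE w (th ord0)).
- by move=> x x' m u s w /=; rewrite -psi_nat.
Defined.

Lemma ran_value_unit n (b : A_infty T n) (x : D) (f : hom (sval x) T) :
  ran_value (ran_unit A_infty P T n b) f = assoc_act (f : tree_map _ _) b.
Proof.
by rewrite /ran_value /= [X in assoc_act X](@cmpm1 Omega_c).
Qed.

End RanAssoc.

(** * Gluing natural families when [k] is at least [3] *)

Section Dendroidal3.
Variables (k : nat) (T : closed_tree) (n : nat).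
Hypothesis k3 : (3 <= k)%N.

Definition subtree_le (A : {set T}) (A3 : (#|A| <= 3)%N) :
    full (dendroidal k) :=
  exist _ (subtree A : Omega_c) (subtree_dendroidal (leq_trans A3 k3)).

Lemma card_pair (x y : T) : (#|[set x; y]| <= 3)%N.
Proof. by rewrite cards2; case: eqP. Qed.

Lemma card_triple (x y z : T) : (#|[set x; y; z]| <= 3)%N.
Proof.
by rewrite setUC cardsU1 cards2; case: (_ \notin _); case: (_ != _).
Qed.

(** Restriction to the subtree spanned by [x] and [y] already determines the planar order of that
    pair. *)
Lemma to_Rk_inj : injective (to_Rk k A_infty (T : Omega_c) n).
Proof.
move=> a b ab; apply: assoc_planar_inj => x y xy.
pose X := subtree_le (card_pair x y).
pose i := subtree_incl [set x; y].
pose x' : subtree [set x; y] := subtree_pt (set21 x y).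
pose y' : subtree [set x; y] := subtree_pt (set22 x y).
have xy' : x' >< y' by rewrite -subtree_incl_incomparable.
have := congr1 (fun c => ran_value c (i : hom (sval X) (T : Omega_c))) ab.
rewrite !ran_value_unit => /(congr1 (fun c => planar_order c x' y')).
by rewrite !planar_order_act.
Qed.

Section Glue.
Variable a : Rk k A_infty (T : Omega_c) n.
Local Notation D := (full (dendroidal k)).

Lemma ran_value_factor (X Y : D) (f : hom (sval X) (T : Omega_c))
    (g : hom (sval Y) (T : Omega_c)) (h : tree_map (sval X) (sval Y))
    (u v : sval X) :
  tree_comp g h = f -> u >< v ->
  planar_order (ran_value a f) u v = planar_order (ran_value a g) (h u) (h v).
Proof.
move=> <- uv; rewrite -planar_order_act //; congr (planar_order _ u v).
exact: (ran_value_nat a (h : hom X Y) g).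
Qed.

Definition glued_order (x y : T) : bool :=
  planar_order
    (ran_value a
      (subtree_incl [set x; y] : hom (sval (subtree_le (card_pair x y))) _))
    (subtree_pt (set21 x y)) (subtree_pt (set22 x y)).

(* [f] restricted to [{\bot, u, v}] and the inclusion of [{\bot, f u, f v}] both
   factor through [{\bot, f \bot, f u, f v}]; the extra edge is needed since [f]
   need not preserve the root. *)
Lemma glued_orderE (X : D) (f : hom (sval X) (T : Omega_c)) (u v : sval X) :
  u >< v ->
  planar_order (ran_value a f) u v
    = glued_order ((f : tree_map _ _) u) ((f : tree_map _ _) v).
Proof.
case: X f u v => [X dX] /= f u v uv.
have uv3 : (#|[set u; v]| <= k)%N.
  by apply: leq_trans k3; rewrite cards2; case: eqP.
pose S : D := exist _ (subtree [set u; v] : Omega_c) (subtree_dendroidal uv3).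
pose B := [set f \bot; f u; f v].
pose SB := subtree_le (card_triple (f \bot) (f u) (f v)).
pose i : tree_map (subtree [set u; v]) X := subtree_incl [set u; v].
pose u' : subtree [set u; v] := subtree_pt (set21 u v).
pose v' : subtree [set u; v] := subtree_pt (set22 u v).
have uv' : u' >< v' by rewrite -subtree_incl_incomparable.
have [g gE] : exists g : tree_map _ (subtree B),
    tree_comp (subtree_incl B) g = tree_comp f i.
  apply: subtree_lift => x; have := subtree_valP x; rewrite /= !inE.
  by case/or3P => /eqP->; rewrite eqxx ?orbT.
have [h hE] : exists h : tree_map (subtree [set f u; f v]) (subtree B),
    tree_comp (subtree_incl B) h = subtree_incl [set f u; f v].
  apply: subtree_lift => x; have := subtree_valP x; rewrite /= !inE.
  by case/or3P => /eqP->; rewrite eqxx ?orbT.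
have fuv' : (subtree_pt (set21 (f u) (f v)) : subtree _)
    >< subtree_pt (set22 (f u) (f v)).
  by rewrite -subtree_incl_incomparable; apply: (tfun_indep f uv).
transitivity (planar_order
  (ran_value a (tree_comp f i : hom (sval S) (T : Omega_c))) u' v').
  exact/esym/(@ran_value_factor S (exist _ X dX) _ f i).
rewrite (@ran_value_factor S SB _ (subtree_incl B) g _ _ gE) //.
rewrite /glued_order 
  (@ran_value_factor (subtree_le (card_pair (f u) (f v))) SB
     _ (subtree_incl B) h _ _ hE) //.
have ghE (x : subtree [set u; v]) (y : subtree [set f u; f v]) :
    f (subtree_val x) = subtree_val y -> g x = h y.
  move=> xy; apply: val_inj.
  have := congr1 (fun c : tree_map _ _ => c x) gE.
  have := congr1 (fun c : tree_map _ _ => c y) hE.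
  by rewrite /= xy => <- <-.
by congr (planar_order _ _ _); apply: ghE.
Qed.

(** Reduces an axiom on at most three edges to the subtree they span, where the family provides an
    actual element of [assoc]. *)
Lemma glued_order_subtree (A : {set T}) : (#|A| <= 3)%N ->
  exists2 p : rel (subtree A), planar p &
    forall x y (xA : x \in A) (yA : y \in A), x >< y ->
      glued_order x y = p (subtree_pt xA) (subtree_pt yA).
Proof.
move=> A3.
pose f : hom (sval (subtree_le A3)) (T : Omega_c) := subtree_incl A.
exists (planar_order (ran_value a f)); first exact: planar_order_planar.
by move=> x y xA yA xy; rewrite glued_orderE.
Qed.

Lemma glued_order_planar : planar glued_order.
Proof.
have pt_inc (A : {set T}) x y (xA : x \in A) (yA : y \in A) :
    x >< y -> (subtree_pt xA : subtree A) >< subtree_pt yA.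
  by move=> xy; rewrite -subtree_incl_incomparable.
have anti x y : x >< y -> glued_order x y = ~~ glued_order y x.
  move=> xy; have [p [p1 _ _] pE] := glued_order_subtree (card_pair x y).
  rewrite (pE x y (set21 x y) (set22 x y)) //.
  rewrite (pE y x (set22 x y) (set21 x y)) 1?incomparableC //.
  exact/p1/pt_inc.
(* Invariance concerns four edges, one too many for [glued_order_subtree]; moving one edge at a time
   involves only three. *)
have sub s1 s2 x : s1 >< s2 -> s1 <= x -> glued_order x s2 = glued_order s1 s2.
  move=> s12 s1x.
  have [p [_ _ p3] pE] := glued_order_subtree (card_triple s1 s2 x).
  have m1 : s1 \in [set s1; s2; x] by rewrite !inE eqxx.
  have m2 : s2 \in [set s1; s2; x] by rewrite !inE eqxx orbT.
  have m3 : x \in [set s1; s2; x] by rewrite !inE eqxx orbT.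
  rewrite (pE _ _ m3 m2) ?(pE _ _ m1 m2) //; last first.
    exact: incomparable_le s12 s1x (lexx s2).
  by apply: p3; rewrite ?pt_inc // -Order.le_val.
split=> // [x y z xy yz xz|s1 s2 x1 x2 s12 sx1 sx2].
- have [p [_ p2 _] pE] := glued_order_subtree (card_triple x y z).
  have m1 : x \in [set x; y; z] by rewrite !inE eqxx.
  have m2 : y \in [set x; y; z] by rewrite !inE eqxx orbT.
  have m3 : z \in [set x; y; z] by rewrite !inE eqxx orbT.
  rewrite (pE _ _ m1 m2) // (pE _ _ m2 m3) // (pE _ _ m1 m3) //.
  by apply: p2; apply: pt_inc.
(* First [s1] moves to [x1], then [s2] to [x2]; [anti] exchanges the arguments for the second
   move. *)
- have x1s2 := incomparable_le s12 sx1 (lexx s2).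
  rewrite -(sub s1 s2 x1) // anti; last exact: incomparable_le s12 sx1 sx2.
  by rewrite (sub s2) 1?incomparableC // [in RHS]anti.
Qed.

(** The preimage is the glued order: by [glued_orderE] it restricts to the given family along every
    [f]. *)
Lemma to_Rk_surj : exists b, to_Rk k A_infty (T : Omega_c) n b = a.
Proof.
exists (assoc_of_planar glued_order_planar); apply: ran_value_inj => X f.
rewrite ran_value_unit; apply: assoc_planar_inj => u v uv.
rewrite planar_order_act // planar_order_assoc_of_planar ?glued_orderE //.
exact: tfun_indep.
Qed.

End Glue.
End Dendroidal3.

Lemma to_Rk_equivalence k : (3 <= k)%N -> equivalence (to_Rk k A_infty).
Proof.
move=> k3 T; apply: bijective_homotopy_equivalence => n.
  exact: to_Rk_inj.
exact: to_Rk_surj.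
Qed.

(** Two out of three for bijections: composing the step with the unit at [k.+1] gives the unit at
    [k]. *)
Lemma Rk_step_equivalence k : (3 <= k)%N -> equivalence (Rk_step k A_infty).
Proof.
move=> k3 T; have k3' := leqW k3.
have stepE n b : Rk_step k A_infty T n (to_Rk k.+1 A_infty T n b)
    = to_Rk k A_infty T n b by exact: ran_compare_unit.
apply: bijective_homotopy_equivalence => n.
  move=> a a'; have [b <-] := to_Rk_surj k3' a.
  have [b' <-] := to_Rk_surj k3' a'.
  by rewrite !stepE => /(to_Rk_inj k3)->.
move=> a; have [b <-] := to_Rk_surj k3 a.
by exists (to_Rk k.+1 A_infty T n b); rewrite stepE.
Qed.

(** * The case [k = 1] *)

Lemma assoc_dendroidal1_eq (T : closed_tree) (a b : assoc T) :
  dendroidal 1 (T : Omega_c) -> a = b.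
Proof.
move=> T1; apply: assoc_planar_inj => x y.
by rewrite (dendroidal1_comparable T1).
Qed.

(** Without incomparable pairs every relation is planar; the constant one serves to exhibit an
    element of [assoc T]. *)
Lemma planar_dendroidal1 (T : closed_tree) :
  dendroidal 1 (T : Omega_c) -> planar (fun _ _ : T => true).
Proof. by move=> T1; split=> // x y; rewrite (dendroidal1_comparable T1). Qed.

Definition R1_to_E : presheaf_map (Rk 1 A_infty) E_infty.
Proof.
by exists (fun T => @SetPresheafMap Delta _ (discrete unit)
  (fun _ _ => tt) (fun _ _ _ _ => erefl)).
Defined.

Lemma R1_to_E_equivalence : equivalence R1_to_E.
Proof.
move=> T; apply: bijective_homotopy_equivalence => n.
  (* [T] is arbitrary, but the families are indexed by linear trees over it, where the values are
     unique. *)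
  move=> a b _; apply: ran_value_inj => x f.
  exact: assoc_dendroidal1_eq (svalP x).
(* The unique elements over the linear trees form a family, and uniqueness makes it natural. *)
case; suff a : Rk 1 A_infty T n by exists a.
apply: (@ran_of_family (dendroidal 1) T n
  (fun x _ => assoc_of_planar (planar_dendroidal1 (svalP x)))) => x x' u f.
exact: assoc_dendroidal1_eq (svalP x').
Qed.

Theorem proposition5p24 :
  (forall k : nat, (3 <= k)%N -> equivalence (to_Rk k A_infty)) /\
  (forall k : nat, (3 <= k)%N -> equivalence (Rk_step k A_infty)) /\
  (exists f : presheaf_map (Rk 1 A_infty) E_infty, equivalence f).
Proof.
split; first exact: to_Rk_equivalence.
split; first exact: Rk_step_equivalence.
by exists R1_to_E; apply: R1_to_E_equivalence.
Qed.
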